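(* Let $G=(\mathcal{V},\mathcal{E})$ be a finite undirected connected simple graph with $m\geqslant 1$ edges, and consider any random walk on $G$ defined by an edge-weight function, with asymmetry $\tau$. Then $\mathcal{H}(G)=\max_{x,y\in\mathcal{V}}\mathcal{H}(x,y)\leqslant\mathcal{F}(\tau,m)$, where $$\mathcal{F}(t,m)=m+\sum_{k=1}^{m-1}2(m-k)t^k.$$
   Context: An edge-weight function assigns a positive weight $w(x,y)=w(y,x)$ to each edge and defines the random walk with $p_{xy}=w(x,y)/\sum_z w(x,z)$. The asymmetry is $\tau=\max_x\max_{y,z\in\mathcal{N}(x)}w(x,y)/w(x,z)$, where $\mathcal{N}(x)$ is the set of neighbors of $x$. $\mathcal{H}(x,y)$ is the expected number of steps for the walk started at $x$ to first reach $y$. *)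

(* Defs.v *)
From mathcomp Require Import all_boot all_order all_algebra.
From mathcomp Require Import all_classical all_reals all_analysis.

Set Implicit Arguments.
Unset Strict Implicit.
Unset Printing Implicit Defensive.

Import Order.TTheory GRing.Theory Num.Theory.

Local Open Scope classical_set_scope.
Local Open Scope ring_scope.

(* A simple graph on V is a symmetric irreflexive adjacency relation e. *)
Definition simple_graph (V : finType) (e : rel V) : Prop :=
  symmetric e /\ irreflexive e.

Definition connected_graph (V : finType) (e : rel V) : Prop :=
  forall x y : V, connect e x y.

Definition edges (V : finType) (e : rel V) : {set {set V}} :=
  [set [set a.1; a.2]%SET | a : V * V & e a.1 a.2]%SET.

(* Weights live on edges only: the values of w at non-adjacent pairs are
   unconstrained, and no definition below reads them. *)
Definition edge_weight (R : realType) (V : finType) (e : rel V)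
    (w : V -> V -> R) : Prop :=
  forall x y : V, e x y -> 0 < w x y /\ w x y = w y x.

Definition trans_prob (R : realType) (V : finType) (e : rel V)
    (w : V -> V -> R) (x y : V) : R :=
  if e x y then w x y / \sum_(z | e x z) w x z else 0.

(* The default value 0 of the maxima is immaterial when there is an edge,
   since all the ratios are positive. *)
Definition asymmetry (R : realType) (V : finType) (e : rel V)
    (w : V -> V -> R) : R :=
  \big[Num.max/0]_(x : V) \big[Num.max/0]_(y | e x y)
    \big[Num.max/0]_(z | e x z) (w x y / w x z).

(* X is the Markov chain with transition matrix p, and Pr x is the law under
   which it starts at x: each X n is measurable for the discrete
   sigma-algebra on V, and the finite-dimensional distributions are
   Pr x (X_0 = s_0, ..., X_n = s_n)
     = 1_{s_0 = x} p(s_0, s_1) ... p(s_(n-1), s_n). *)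
Definition markov_chain (R : realType) (V : finType) (p : V -> V -> R)
    (d : measure_display) (Omega : measurableType d)
    (Pr : V -> probability Omega R) (X : nat -> Omega -> V) : Prop :=
  (forall (n : nat) (v : V), measurable [set omega | X n omega = v]) /\
  (forall (x : V) (n : nat) (s : nat -> V),
     Pr x [set omega | forall i : nat, (i <= n)%N -> X i omega = s i] =
     ((s 0%N == x)%:R * \prod_(i < n) p (s i) (s i.+1))%:E).

(* min {n >= 0 | X_n = y}, equal to +oo if y is never reached; in
   particular it is 0 when the walk starts at y. *)
Definition hitting_time (R : realType) (V : finType) (Omega : Type)
    (X : nat -> Omega -> V) (y : V) (omega : Omega) : \bar R :=
  ereal_inf [set (n%:R : R)%:E | n in [set n : nat | X n omega = y]].

Definition exp_hitting_time (R : realType) (V : finType)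
    (d : measure_display) (Omega : measurableType d)
    (Pr : V -> probability Omega R) (X : nat -> Omega -> V) (x y : V) : \bar R :=
  (\int[Pr x]_omega hitting_time R X y omega)%E.

Definition max_hitting_time (R : realType) (V : finType)
    (d : measure_display) (Omega : measurableType d)
    (Pr : V -> probability Omega R) (X : nat -> Omega -> V) : \bar R :=
  \big[maxe/-oo%E]_(x : V) \big[maxe/-oo%E]_(y : V) exp_hitting_time Pr X x y.

Definition hitting_bound (R : realType) (t : R) (m : nat) : R :=
  m%:R + \sum_(1 <= k < m) 2 * (m - k)%:R * t ^+ k.

(* Main.v *)
(**
Let [h] be the expected hitting time of [y] truncated at time [N]. Away from
[y] it satisfies [h v <= 1 + \sum_z p v z * h z], that is, seen as a potential,
the current leaving [v] is at most its total weight [W v].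

Let [S] be a connected set containing [x] but not [y], all of whose outer
neighbors have [h <= c], and let [u] be the boundary vertex of [S] with the
smallest [h]. Every edge of the cut of [S] drops [h] by at least [h u - c], so
[(h u - c) * w(cut) <= W(S) = w(cut) + 2 * w(edges inside S)]. Listing the
edges inside [S] so that each one touches the cut or an earlier edge, the
[k]-th one has weight at most [t ^+ k * w(cut)]. With [n] edges inside [S] this
gives [h u - c <= 1 + 2 * (t + ... + t ^+ n)].

Now replace [S] by the component of [x] in [S] minus [u]: since [S] is
connected, this loses at least one inner edge. Starting from the component of
[x] in the complement of [y], at most [m] rounds reach [u = x], and the
increments add up to [hitting_bound t m]. Monotone convergence in [N] concludes,
without any appeal to the finiteness of the expected hitting time.
*)
Require Import Defs.
From mathcomp Require Import all_boot all_order all_algebra.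
From mathcomp Require Import all_classical all_reals all_analysis.
From mathcomp Require Import zify ring lra.

Set Implicit Arguments.
Unset Strict Implicit.
Unset Printing Implicit Defensive.

Import Order.TTheory GRing.Theory Num.Theory.

Local Open Scope ring_scope.

(** * Geometric sums and the recursion of the bound *)

Section GeometricSums.
Variables (R : realType) (t : R).

Definition geom_sum (n : nat) : R := \sum_(1 <= k < n.+1) t ^+ k.

Lemma geom_sum0 : geom_sum 0 = 0.
Proof. by rewrite /geom_sum big_geq. Qed.

Lemma geom_sumS n : geom_sum n.+1 = t * (1 + geom_sum n).
Proof.
rewrite /geom_sum big_nat_recl // expr1 mulrDr mulr1 mulr_sumr; congr (_ + _).
by apply: eq_bigr => k _; rewrite exprS.
Qed.

Lemma geom_sum_ge0 n : 0 <= t -> 0 <= geom_sum n.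
Proof. by move=> t0; apply: sumr_ge0 => k _; apply: exprn_ge0. Qed.

(** The increment is the drop allowed in a round with at most [n] inner edges, so the bound
    accumulates round by round. *)
Lemma hitting_boundS n :
  hitting_bound t n.+1 = hitting_bound t n + (1 + 2 * geom_sum n).
Proof.
rewrite /hitting_bound /geom_sum; case: n => [|n].
  by rewrite !big_geq // mulr0 !addr0 add0r.
rewrite (big_nat_recr n.+1) //= subSnn [X in _ = _ + (1 + 2 * X)]big_nat_recr //=.
rewrite -[n.+2%:R]natr1 mulr1 mulrDr mulr_sumr.
under eq_big_nat => k /andP[_ kn].
  rewrite subSn; last by lia.
  rewrite -[(n.+1 - k).+1%:R]natr1 mulrDr mulr1 mulrDl; over.
by rewrite big_split /=; ring.
Qed.

Lemma hitting_bound_ge0 n : 0 <= t -> 0 <= hitting_bound t n.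
Proof.
move=> t0; rewrite addr_ge0 // sumr_ge0 // => k _.
by rewrite !mulr_ge0 ?exprn_ge0.
Qed.

End GeometricSums.

(** * Comparison of weights at a common vertex *)

Lemma asymmetryP (R : realType) (V : finType) (e : rel V) (w : V -> V -> R) :
  edge_weight e w -> forall x y z, e x y -> e x z ->
  w x y <= asymmetry e w * w x z.
Proof.
move=> ew x y z exy exz; have [wz _] := ew _ _ exz.
rewrite -ler_pdivrMr // /asymmetry.
apply: le_trans (le_bigmax _ _ x).
apply: le_trans (le_bigmax_cond _ _ exy).
exact: (le_bigmax_cond _ (fun z => w x y / w x z) exz).
Qed.

Lemma asymmetry_ge1 (R : realType) (V : finType) (e : rel V) (w : V -> V -> R) :
  edge_weight e w -> forall x y, e x y -> 1 <= asymmetry e w.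
Proof.
move=> ew x y exy; have [w0 _] := ew _ _ exy.
by have := asymmetryP ew exy exy; rewrite -[X in X <= _]mul1r ler_pM2r.
Qed.

(** * Cuts, darts and components of a weighted graph *)

Section WeightedGraph.
Variables (R : realType) (V : finType) (e : rel V) (w : V -> V -> R) (t : R).
Hypotheses (e_sym : symmetric e) (e_irr : irreflexive e).
Hypothesis econ : connected_graph e.
Hypothesis ew : edge_weight e w.
Hypotheses (t1 : 1 <= t)
  (wt : forall x y z, e x y -> e x z -> w x y <= t * w x z).

(** Otherwise [X] would be closed under adjacency, hence constant on the connected graph. *)
Lemma exit_edge_exists (X : pred V) x y : X x -> ~~ X y ->
  exists a b, [/\ X a, ~~ X b & e a b].
Proof.
move=> Xx nXy; case: (pickP [pred d : V * V | [&& X d.1, ~~ X d.2 & e d.1 d.2]]).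
  by move=> [a b] /= /and3P[]; exists a, b.
move=> H; have cl : fingraph.closed e X.
  apply: fingraph.intro_closed; first exact: sym_connect_sym.
  move=> a b eab aX; have /= := H (a, b).
  by rewrite eab andbT -topredE /= in aX *; rewrite -!topredE /= aX /= => /negbFE.
have := fingraph.closed_connect cl (econ x y).
by rewrite -!topredE /= Xx (negbTE nXy).
Qed.

(* The darts of [B] are removed by pairs, each time at a vertex incident to a
   dart outside [B]: the [k]-th removed edge has weight at most [t ^+ k * N]. *)
Lemma sum_darts_le n (B : pred (V * V)) (N : R) (y : V) :
  0 <= N -> (forall a b, B (a, b) -> e a b) ->
  (forall a b, B (a, b) -> B (b, a)) -> (forall b, ~~ B (y, b)) ->
  (forall a b c, B (a, c) -> e a b -> ~~ B (a, b) -> w a b <= N) ->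
  (#|B| <= n.*2)%N ->
  \sum_(d | B d) w d.1 d.2 <= 2 * N * geom_sum t n.
Proof.
elim: n B N => [|n IH] B N N0 Be Bsym By BN Bn.
  rewrite big_pred0 ?geom_sum0 ?mulr0 // => d.
  by apply: (card0_eq _ d); apply/eqP; rewrite -leqn0.
have t0 : 0 <= t by apply: le_trans t1.
case: (pickP B) => [[a0 b0] B0|B0]; last first.
  by rewrite big_pred0 // !mulr_ge0 // geom_sum_ge0.
(* The vertices incident to [B] do not include [y], so some edge leaves this set. That edge is not
   in [B], and its inner end carries a dart of [B] to remove. *)
pose X : pred V := [pred a | [exists b, B (a, b)]].
have Xa0 : X a0 by apply/existsP; exists b0.
have [x [z [z' [Bxz exz' nBxz']]]] :
    exists x z z', [/\ B (x, z), e x z' & ~~ B (x, z')].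
  have nXy : ~~ X y by rewrite /= negb_exists; apply/forallP.
  have [a [b [/= /existsP[c Bac] /existsPn nXb eab]]] :=
    exit_edge_exists Xa0 nXy.
  exists a, c, b; split=> //; apply/negP => /Bsym Bba.
  by have := nXb a; rewrite Bba.
have exz := Be _ _ Bxz.
have wxz : w x z <= t * N.
  apply: le_trans (wt exz exz') _; rewrite ler_wpM2l //; exact: BN Bxz _ _.
have nxz : (z, x) != (x, z).
  by apply/eqP => -[zx _]; rewrite zx e_irr in exz.
pose B' : pred (V * V) := [pred d | [&& B d, d != (x, z) & d != (z, x)]].
have B'P d : B' d -> B d by move=> /and3P[].
rewrite (bigD1 (x, z)) //= (bigD1 (z, x)) /=; last by rewrite Bsym.
rewrite (eq_bigl B'); last by move=> d; rewrite /B' /= andbA.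
have [_ ->] := ew exz.
have wzx : w z x <= t * N by have [_ <-] := ew exz.
have cB' : (#|B'| <= n.*2)%N.
  have inB d : (d \in B) = B d by [].
  move: Bn; rewrite (cardD1 (x, z)) (cardD1 (z, x)) !inE /= nxz !inB Bxz.
  rewrite (Bsym _ _ Bxz) /= add1n add1n doubleS !ltnS; apply: leq_trans.
  apply: subset_leq_card; apply/fintype.subsetP => d; rewrite !inE !inB /=.
  by move=> /and3P[-> -> ->].
(* The removed pair, now outside, has weights at most [t * N]; since [1 <= t], the older outside
   darts obey this bound too. *)
have: \sum_(d | B' d) w d.1 d.2 <= 2 * (t * N) * geom_sum t n.
  apply: IH => //.
  - by rewrite mulr_ge0.
  - by move=> a b /B'P/Be.
  - move=> a b /= /and3P[Bab n1 n2]; rewrite /B' /= Bsym //=.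
    have swap u v : ((b, a) == (u, v)) = ((a, b) == (v, u)).
      by rewrite !xpair_eqE andbC.
    by rewrite !swap n1 n2.
  - by move=> b; rewrite /B' /= (negbTE (By b)).
  - move=> a b c /B'P Bac eab; case: (boolP (B (a, b))) => [Bab|nB _].
      by rewrite /B' /= Bab -negb_or negbK => /orP[]/eqP[-> ->].
    by rewrite (le_trans (BN _ _ _ Bac eab nB)) // ler_peMl.
rewrite geom_sumS; lra.
Qed.

Definition induced (A : pred V) : rel V := [rel a b | [&& A a, A b & e a b]].

Definition component (A : pred V) (x : V) : pred V := connect (induced A) x.

(** Each edge inside [S] occurs in both orientations, so [n] edges are counted as [n.*2]. *)
Definition inner_darts (S : pred V) : pred (V * V) :=
  [pred d | [&& S d.1, S d.2 & e d.1 d.2]].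

Lemma componentP (A : pred V) x v : A x -> component A x v -> A v.
Proof.
move=> Ax /connectP[p]; elim: p x Ax => [x Ax _ -> //|z p IH x Ax /=].
by move=> /andP[/and3P[_ Az _] /IH] /[apply]; apply.
Qed.

(** The last edge of a path from [x] to [u]; it is the inner edge lost when [u] is deleted. *)
Lemma component_neighbor (A : pred V) x u : component A x u -> u != x ->
  exists2 s, component A x s & e s u.
Proof.
move=> /connectP[p]; elim/last_ind: p => [_ /= ->|p s _]; first by rewrite eqxx.
rewrite rcons_path last_rcons => /andP[pp /and3P[_ _ es]] -> _.
by exists (last x p) => //; apply/connectP; exists p.
Qed.

Lemma out_neighbor_component (A : pred V) x v z : A x ->
  component A x v -> ~~ component A x z -> e v z -> ~~ A z.
Proof.
move=> Ax Sv nSz evz; apply: contra nSz => Az; have Av := componentP Ax Sv.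
apply: connect_trans Sv (connect1 _).
by rewrite /induced /= Av Az.
Qed.

(** * Height of a potential with bounded outgoing current *)

Variables (y : V) (h : V -> R).
Hypothesis hsub : forall v, v != y ->
  \sum_(z | e v z) w v z * (h v - h z) <= \sum_(z | e v z) w v z.

Lemma flow_out_le (S : pred V) : ~~ S y ->
  \sum_(v | S v) \sum_(z | e v z && ~~ S z) w v z * (h v - h z) <=
  \sum_(v | S v) \sum_(z | e v z) w v z.
Proof.
move=> Sy.
have: \sum_(v | S v) \sum_(z | e v z) w v z * (h v - h z) <=
  \sum_(v | S v) \sum_(z | e v z) w v z.
  by apply: ler_sum => v Sv; apply: hsub; apply: contraNneq Sy => <-.
apply: le_trans.
under [leRHS]eq_bigr => v _ do rewrite (bigID S) /=.
rewrite big_split /=.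
set I := (X in _ <= X + _).
suff -> : I = 0 by rewrite add0r.
(* The current is antisymmetric, so exchanging the two ends of the inner edges changes the sign. *)
have: I = - I.
  rewrite {1}/I; under eq_bigr => v Sv do rewrite big_andbC.
  rewrite (exchange_big_dep S) /=; last by move=> i j _ /andP[].
  rewrite -sumrN; apply: eq_bigr => v Sv.
  rewrite -sumrN; apply: eq_big => [z|z].
    by rewrite e_sym Sv andbC.
  move=> /andP[Sz /andP[_ ezv]]; have [_ ->] := ew ezv; ring.
by move=> /eqP; rewrite -addr_eq0 -mulr2n mulrn_eq0 /= => /eqP.
Qed.

Lemma boundary_drop_le n (S : pred V) x u c :
  S x -> ~~ S y -> (#|inner_darts S| <= n.*2)%N ->
  (forall v z, S v -> ~~ S z -> e v z -> h u <= h v /\ h z <= c) ->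
  h u - c <= 1 + 2 * geom_sum t n.
Proof.
move=> Sx Sy Sn Hu.
pose cut : R := \sum_(v | S v) \sum_(z | e v z && ~~ S z) w v z.
have w0 v z : e v z -> 0 <= w v z by move=> /ew[/ltW].
have wcut v z : S v -> ~~ S z -> e v z -> w v z <= cut.
  move=> Sv Sz evz; rewrite /cut (bigD1 v) //= (bigD1 z) /= ?evz //.
  rewrite -addrA lerDl addr_ge0 //; first by apply: sumr_ge0 => i /andP[/andP[/w0]].
  by apply: sumr_ge0 => i _; apply: sumr_ge0 => j /andP[/w0].
have cut0 : 0 < cut.
  have [a [b [Sa Sb eab]]] := exit_edge_exists Sx Sy.
  by apply: lt_le_trans (wcut _ _ Sa Sb eab); have [] := ew eab.
have inner : \sum_(d | inner_darts S d) w d.1 d.2 <= 2 * cut * geom_sum t n.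
  apply: (@sum_darts_le n _ _ y) => //.
  - exact: ltW.
  - by move=> a b /and3P[].
  - by move=> a b /and3P[/= Sa Sb eab]; rewrite /inner_darts /= Sa Sb e_sym.
  - by move=> b; rewrite /inner_darts /= (negbTE Sy).
  - move=> a b d /and3P[/= Sa _ _] eab; rewrite /inner_darts /= Sa eab andbT => Sb.
    exact: wcut.
have := flow_out_le Sy.
(* Inner edges are counted from both ends, cut edges only from the end in [S]. *)
have -> : \sum_(v | S v) \sum_(z | e v z) w v z =
    \sum_(d | inner_darts S d) w d.1 d.2 + cut.
  under eq_bigr => v _ do rewrite (bigID S) /=.
  rewrite big_split /= pair_big_dep /=; congr (_ + _).
  by apply: eq_bigl => d; rewrite /inner_darts /= [e _ _ && _]andbC.
have : (h u - c) * cut <=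
    \sum_(v | S v) \sum_(z | e v z && ~~ S z) w v z * (h v - h z).
  rewrite mulr_sumr; apply: ler_sum => v Sv; rewrite mulr_sumr.
  apply: ler_sum => z /andP[evz Sz]; rewrite mulrC ler_wpM2l ?w0 //.
  have [] := Hu v z Sv Sz evz; lra.
move=> H1 H2; rewrite -(ler_pM2r cut0); lra.
Qed.

Lemma component_height_le n (A : pred V) x c :
  A x -> ~~ A y -> (#|inner_darts (component A x)|.+2 <= n.*2)%N ->
  (forall v z, component A x v -> ~~ component A x z -> e v z -> h z <= c) ->
  h x <= c + hitting_bound t n.
Proof.
have t0 : 0 <= t by apply: le_trans t1.
(* The offset 2 allows one inner edge fewer than [n], so [n = 0] contradicts the cardinality
   hypothesis. *)
elim: n A c => [//|n IH] A c Ax Ay; set S := component A x => Sn Hc.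
have {}Sn : (#|inner_darts S| <= n.*2)%N by rewrite doubleS !ltnS in Sn.
have Sx : S x by exact: connect0.
have Sy : ~~ S y by apply: contra Ay => /(componentP Ax).
have [a [b [Sa Sb eab]]] := exit_edge_exists Sx Sy.
pose D : pred V := [pred v | S v && [exists z, ~~ S z && e v z]].
have Da : D a by rewrite /D /= Sa; apply/existsP; exists b; rewrite Sb.
case: (arg_minP h Da) => u /andP[Su _] umin.
have drop : h u - c <= 1 + 2 * geom_sum t n.
  apply: (boundary_drop_le Sx Sy Sn) => v z Sv Sz evz; split; last exact: Hc evz.
  by apply: umin; rewrite /D /= Sv; apply/existsP; exists z; rewrite Sz.
have hb0 : 0 <= hitting_bound t n by exact: hitting_bound_ge0.
have g0 : 0 <= geom_sum t n by exact: geom_sum_ge0.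
rewrite hitting_boundS; have [ux|ux] := eqVneq u x; first by rewrite -ux; lra.
have [s] := component_neighbor Su ux; rewrite -/S => Ss esu.
pose A' : pred V := [pred v | S v && (v != u)].
have A'x : A' x by rewrite /A' /= Sx eq_sym.
(* An outer neighbor of the new component is either [u] or an outer neighbor of [S]. *)
pose c' := Num.max c (h u).
have : h x <= c' + hitting_bound t n.
  apply: (IH A') => //.
  - by rewrite /A' /= (negbTE Sy).
  (* Both darts between [u] and [s] are inner to [S] but not to the new component. *)
  - apply: leq_trans Sn; rewrite [in leqRHS](cardD1 (u, s))
      [in leqRHS](cardD1 (s, u)) !inE /=.
    have su : s != u by apply: contraTneq esu => ->; rewrite e_irr.
    rewrite Su Ss [e u s]e_sym esu xpair_eqE (negbTE su) /= add1n add1n !ltnS.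
    apply: subset_leq_card; apply/fintype.subsetP => -[v z].
    rewrite !inE /=.
    move=> /and3P[/(componentP A'x)/andP[Sv vu] /(componentP A'x)/andP[Sz zu] ->].
    by rewrite -/S Sv Sz !xpair_eqE (negbTE vu) (negbTE zu) andbF.
  - move=> v z /[dup] S'v /(componentP A'x)/andP[Sv _] S'z evz.
    have := out_neighbor_component A'x S'v S'z evz.
    rewrite /A' /= negb_and negbK => /orP[Sz|/eqP ->]; rewrite le_max ?lexx ?orbT //.
    by rewrite (Hc v z).
have : c' <= c + (1 + 2 * geom_sum t n) by rewrite ge_max; apply/andP; split; lra.
lra.
Qed.

(** The two darts of an edge at [y] are not inner to [S]; this supplies the offset 2 for the first
    round. *)
Lemma inner_darts_lt (S : pred V) : ~~ S y -> (exists z, e y z) ->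
  (#|inner_darts S|.+2 <= #|[pred d : V * V | e d.1 d.2]|)%N.
Proof.
move=> Sy [z eyz]; rewrite [in leqRHS](cardD1 (y, z))
  [in leqRHS](cardD1 (z, y)) !inE /= [e z y]e_sym eyz.
have zy : z != y by apply: contraTneq eyz => ->; rewrite e_irr.
rewrite xpair_eqE (negbTE zy) /= add1n add1n !ltnS.
apply: subset_leq_card; apply/fintype.subsetP => -[u v].
rewrite !inE /=.
move=> /and3P[Su Sv ->]; rewrite !xpair_eqE andbT.
have /negbTE-> : u != y by apply: contraNneq Sy => <-.
have /negbTE-> : v != y by apply: contraNneq Sy => <-.
by rewrite andbF.
Qed.

(** The map from darts to edges has fibers of at most two elements. *)
Lemma card_darts_le : (#|[pred d : V * V | e d.1 d.2]| <= #|edges e|.*2)%N.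
Proof.
pose f (d : V * V) := [set d.1; d.2]%SET.
rewrite -[leqLHS]sum1_card (partition_big f [in edges e]) /=; last first.
  by move=> d ed; apply/imsetP; exists d; rewrite ?inE.
rewrite -muln2 -sum_nat_const; apply: leq_sum => E /imsetP[[a b] _ ->].
rewrite sum1_card; apply: (@leq_trans #|[:: (a, b); (b, a)]|); last exact: card_size.
apply: subset_leq_card; apply/fintype.subsetP => -[c d].
rewrite !inE /= !xpair_eqE => /andP[+ /eqP fcd]; rewrite inE /= => ecd.
have cd : c != d by apply: contraTneq ecd => ->; rewrite e_irr.
have := in_set2 c a b; have := in_set2 d a b.
rewrite -!fcd !in_set2 !eqxx orbT /= => /esym Hd /esym Hc.
move: cd; case/orP: Hd => /eqP->; case/orP: Hc => /eqP->; rewrite !eqxx ?orbT //.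
Qed.

Lemma subsolution_le x : (1 <= #|edges e|)%N -> h y = 0 ->
  h x <= hitting_bound t #|edges e|.
Proof.
move=> m1 hy; have t0 : 0 <= t by apply: le_trans t1.
have [->|xy] := eqVneq x y; first by rewrite hy hitting_bound_ge0.
pose A : pred V := [pred v | v != y].
(* In the first round [y] is the only outer neighbor, so [c = h y = 0]. *)
rewrite -[leRHS]add0r; apply: (@component_height_le _ A) => //.
- by rewrite /A /= eqxx.
- apply: leq_trans card_darts_le; apply: inner_darts_lt.
    by apply/negP => /(componentP (A := A) xy); rewrite /A /= eqxx.
  have nxy : ~~ pred1 y x by [].
  have [a [b [/= /eqP-> _ eyb]]] :=
    @exit_edge_exists (pred1 y) _ _ (eqxx y) nxy.
  by exists b.
- move=> v z Sv nSz evz.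
  have := out_neighbor_component (A := A) xy Sv nSz evz.
  by rewrite /A /= negbK => /eqP->; rewrite hy.
Qed.

End WeightedGraph.

(** * Tail probabilities computed from the transition matrix *)

Section Survival.
Variables (R : realType) (V : finType) (p : V -> V -> R) (y : V).
Hypothesis p_ge0 : forall x z, 0 <= p x z.

(* Probability that the chain started at [x] avoids [y] at times [0, ..., n]. *)
Fixpoint survival (n : nat) (x : V) : R :=
  (x != y)%:R * (if n is n'.+1 then \sum_z p x z * survival n' z else 1).

(** For a chain with hitting time [T] of [y], this is the expectation of [min(T, N)] as a sum of
    tails. *)
Definition truncated_time (N : nat) (x : V) : R := \sum_(n < N) survival n x.

Lemma survival_ge0 n x : 0 <= survival n x.
Proof.
elim: n x => [|n IH] x /=; rewrite mulr_ge0 //.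
by apply: sumr_ge0 => z _; rewrite mulr_ge0.
Qed.

Lemma survival_target n : survival n y = 0.
Proof. by case: n => [|n] /=; rewrite eqxx mul0r. Qed.

Lemma truncated_time_target N : truncated_time N y = 0.
Proof. by rewrite /truncated_time big1 // => n _; exact: survival_target. Qed.

(** First-step analysis evaluates the time truncated at [N.+1], which dominates the one truncated at
    [N]. *)
Lemma truncated_time_le N x : x != y ->
  truncated_time N x <= 1 + \sum_z p x z * truncated_time N z.
Proof.
move=> xy; apply: (@le_trans _ _ (truncated_time N.+1 x)).
  by rewrite /truncated_time big_ord_recr /= lerDl survival_ge0.
rewrite /truncated_time big_ord_recl /= xy mulr1 lerD2l.
under [leRHS]eq_bigr => z _ do rewrite mulr_sumr.
rewrite exchange_big /=; apply: ler_sum => n _.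
by rewrite mul1r.
Qed.

End Survival.

Lemma trans_prob_ge0 (R : realType) (V : finType) (e : rel V)
    (w : V -> V -> R) : edge_weight e w -> forall x z, 0 <= trans_prob e w x z.
Proof.
move=> ew x z; rewrite /trans_prob; case: ifP => // /ew[w0 _].
by apply: divr_ge0; [exact: ltW | apply: sumr_ge0 => v /ew[/ltW]].
Qed.

Lemma truncated_time_subsolution (R : realType) (V : finType) (e : rel V)
    (w : V -> V -> R) y N v : edge_weight e w -> v != y ->
  let h := truncated_time (trans_prob e w) y N in
  \sum_(z | e v z) w v z * (h v - h z) <= \sum_(z | e v z) w v z.
Proof.
move=> ew vy /=; set W := \sum_(z | e v z) w v z.
have W0 : 0 <= W by apply: sumr_ge0 => z /ew[/ltW].
have := truncated_time_le (trans_prob_ge0 ew) N vy.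
move: (truncated_time _ _ _) => h /(ler_wpM2l W0); rewrite mulrDr mulr1 -lerBlDr.
congr (_ <= _); rewrite mulr_sumr.
under [RHS]eq_bigr => z _ do rewrite mulrBr.
rewrite sumrB -mulr_suml; congr (_ - _).
rewrite [RHS]big_mkcond /=; apply: eq_bigr => z _; rewrite /trans_prob.
case: ifP => evz; last by rewrite mul0r mulr0.
have : W != 0.
  rewrite gt_eqF // /W (bigD1 z) //= ltr_wpDr //; last by have [] := ew _ _ evz.
  by apply: sumr_ge0 => u /andP[/ew[/ltW]].
by rewrite -/W => Wn0; field.
Qed.

(** * From the law of the chain to expected hitting times *)

Local Open Scope classical_set_scope.

Lemma measure_le_sum_fibers (R : realType) (V : finType)
    (d : measure_display) (Omega : measurableType d)
    (mu : probability Omega R) (A : set Omega) (F : V -> set Omega) :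
  measurable A -> (forall v, measurable (F v)) ->
  (forall omega, A omega -> exists v, F v omega) ->
  (mu A <= \sum_v mu (F v))%E.
Proof.
move=> mA mF cover.
have mU (r : seq V) : measurable (\big[setU/set0]_(v <- r) F v).
  exact: bigsetU_measurable.
apply: (@le_trans _ _ (mu (\big[setU/set0]_(v <- index_enum V) F v))).
  apply: le_measure; rewrite ?inE // => omega /cover[v Fv].
  by rewrite -bigcup_seq /=; exists v => //=; exact: mem_index_enum.
elim: (index_enum V) => [|v r IH]; first by rewrite !big_nil measure0.
rewrite !big_cons; apply: le_trans (measureU2 _ (mF v) (mU r)) _.
exact: leeD2l.
Qed.

Section HittingTime.
Variables (R : realType) (V : finType) (p : V -> V -> R).
Variables (d : measure_display) (Omega : measurableType d).
Variables (Pr : V -> probability Omega R) (X : nat -> Omega -> V).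
Hypothesis mc : markov_chain p Pr X.
Variable y : V.

Definition avoiding (m n : nat) : set Omega :=
  [set omega | forall i, (m <= i <= n)%N -> X i omega <> y].

Lemma measurable_avoiding m n : measurable (avoiding m n).
Proof.
have -> : avoiding m n =
    \bigcap_(i in [set i | (m <= i <= n)%N]) ~` [set omega | X i omega = y].
  by apply/seteqP; split.
apply: bigcap_measurableType => i _; apply: measurableC; exact: mc.1.
Qed.

Lemma measurable_cylinder n (s : nat -> V) :
  measurable [set omega | forall i, (i <= n)%N -> X i omega = s i].
Proof.
have -> : [set omega | forall i, (i <= n)%N -> X i omega = s i] =
    \bigcap_(i in [set i | (i <= n)%N]) [set omega | X i omega = s i].
  by apply/seteqP; split.
by apply: bigcap_measurableType => i _; exact: mc.1.
Qed.

(** The prescribed past is extended by one step, over all values of [X n.+1], until only cylinders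
    remain; their laws are given. *)
Lemma cylinder_avoiding_le x k n s :
  (Pr x ([set omega | forall i, (i <= n)%N -> X i omega = s i] `&`
         avoiding n (n + k)) <=
   ((s 0 == x)%:R * \prod_(i < n) p (s i) (s i.+1) * survival p y k (s n))%:E)%E.
Proof.
set cyl := fun n s => [set omega | forall i, (i <= n)%N -> X i omega = s i].
elim: k n s => [|k IH] n s.
all: have [sy|sy] := eqVneq (s n) y.
(* If [s n = y] the event is empty and the survival factor vanishes. *)
all: try by rewrite [X in Pr x X](_ : _ = set0) ?measure0 ?sy ?survival_target
  ?mulr0 //; apply/seteqP; split => // omega [C /(_ n)]; rewrite leqnn leq_addr
  => /(_ isT); rewrite C.
  rewrite /= sy !mulr1 -mc.2; apply: le_measure; rewrite ?inE.
  - by apply: measurableI; [exact: measurable_cylinder|exact: measurable_avoiding].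
  - exact: measurable_cylinder.
  - by move=> omega [].
pose s' z i := if (i <= n)%N then s i else z.
apply: (@le_trans _ _ (\sum_z Pr x (cyl n.+1 (s' z) `&` avoiding n.+1 (n.+1 + k)))%E).
  apply: measure_le_sum_fibers.
  - by apply: measurableI; [exact: measurable_cylinder|exact: measurable_avoiding].
  - by move=> z; apply: measurableI; [exact: measurable_cylinder|exact: measurable_avoiding].
  - move=> omega [C A]; exists (X n.+1 omega); split.
      move=> i; rewrite /s' leq_eqVlt ltnS => /orP[/eqP->|le_in]; first by rewrite ltnn.
      by rewrite le_in C.
    by move=> i /andP[n1 n2]; apply: A; rewrite (ltnW n1) addnS -addSn.
apply: le_trans (lee_sum _ (fun z _ => IH n.+1 (s' z))) _.
rewrite sumEFin lee_fin /= sy mul1r mulr_sumr; apply: ler_sum => z _.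
rewrite big_ord_recr /= /s' leq0n leqnn ltnn -!mulrA.
by under eq_bigr => i _ do rewrite (ltnW (ltn_ord i)) ltn_ord.
Qed.

Lemma avoiding_le x k : (Pr x (avoiding 0 k) <= (survival p y k x)%:E)%E.
Proof.
set cyl := fun z => [set omega | forall i, (i <= 0)%N -> X i omega = z].
apply: (@le_trans _ _ (\sum_z Pr x (cyl z `&` avoiding 0 k))%E).
  apply: measure_le_sum_fibers.
  - exact: measurable_avoiding.
  - move=> z; apply: measurableI; last exact: measurable_avoiding.
    exact: (measurable_cylinder 0 (fun=> z)).
  - move=> omega A; exists (X 0%N omega); split => // i.
    by rewrite leqn0 => /eqP->.
apply: le_trans (lee_sum _ (fun z _ => cylinder_avoiding_le x k 0 (fun=> z))) _.
rewrite sumEFin lee_fin (bigD1 x) //= eqxx big_ord0 !mul1r big1 ?addr0 //.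
by move=> z /negbTE->; rewrite !mul0r.
Qed.

(** A time [T] is the sum over [n] of the indicators of [n < T], also when [T] is infinite. *)
Lemma hitting_time_series omega :
  hitting_time R X y omega = (\sum_(0 <= n <oo) (\1_(avoiding 0 n) omega : R)%:E)%E.
Proof.
have ind0 n : (0 <= (\1_(avoiding 0 n) omega : R)%:E)%E by rewrite lee_fin indicE.
have [hit|nhit] := pselect (exists n, X n omega == y); last first.
  have A n : avoiding 0 n omega.
    by move=> i _ Xi; apply: nhit; exists i; apply/eqP.
  rewrite /hitting_time [X in ereal_inf X](_ : _ = set0); last first.
    apply/seteqP; split => // r [n Xn _]; case: nhit; exists n; exact/eqP.
  rewrite ereal_inf0; apply/esym/eqyP => r r0.
  apply: le_trans (nneseries_lim_ge (Num.bound r) (fun n _ _ => ind0 n)).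
  under eq_bigr => i _ do rewrite indicE mem_set //.
  by rewrite sumEFin lee_fin sumr_const_nat subn0 ltW // archi_boundP // ltW.
case: (ex_minnP hit) => k /eqP Xk kmin.
have -> : hitting_time R X y omega = k%:R%:E.
  apply/eqP; rewrite eq_le; apply/andP; split.
    by apply: ereal_inf_lbound; exists k.
  apply: le_ereal_inf_tmp => _ [n /eqP Xn <-].
  by rewrite lee_fin ler_nat kmin.
rewrite (nneseries_split 0 k) ?eseries0 ?adde0; last first.
- by move=> n _; exact: ind0.
- move=> n; rewrite add0n => kn _; rewrite indicE memNset // => A.
  exact: (A k _ Xk).
rewrite add0n big_nat; under eq_bigr => i /andP[_ ik].
  rewrite indicE mem_set; first over.
  move=> j /andP[_ ji] Xj; have := kmin j; rewrite Xj eqxx => /(_ isT).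
  by rewrite leqNgt (leq_ltn_trans ji ik).
by rewrite -big_nat sumEFin sumr_const_nat subn0.
Qed.

Lemma exp_hitting_time_le x (B : R) :
  (forall N, truncated_time p y N x <= B) ->
  (exp_hitting_time Pr X x y <= B%:E)%E.
Proof.
move=> HB; rewrite /exp_hitting_time.
under eq_integral => omega _ do rewrite hitting_time_series.
(* Monotone convergence: the integral of the series is the limit of its partial sums, each at most
   [truncated_time]. *)
rewrite integral_nneseries //=; last first.
  move=> n; apply/measurable_realfun.measurable_EFinP.
  exact/measurable_realfun.measurable_indic/measurable_avoiding.
have I0 n : (0 <= \int[Pr x]_omega (\1_(avoiding 0 n) omega : R)%:E)%E.
  by apply: integral_ge0 => omega _; rewrite lee_fin indicE.
apply: lime_le; first by apply: is_cvg_nneseries => n _ _; exact: I0.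
near=> N; apply: (@le_trans _ _ (truncated_time p y N x)%:E); last by rewrite lee_fin.
rewrite big_mkord -sumEFin; apply: lee_sum => n _.
rewrite integral_indic //; last exact: measurable_avoiding.
by rewrite setIT avoiding_le.
Unshelve. all: by end_near.
Qed.

End HittingTime.

Theorem theorem9 (R : realType) (V : finType) (e : rel V) (m : nat)
    (w : V -> V -> R)
    (d : measure_display) (Omega : measurableType d)
    (Pr : V -> probability Omega R) (X : nat -> Omega -> V) :
  simple_graph e -> connected_graph e ->
  #|edges e| = m -> (1 <= m)%N ->
  edge_weight e w ->
  markov_chain (trans_prob e w) Pr X ->
  (max_hitting_time Pr X <= (hitting_bound (asymmetry e w) m)%:E)%E.

Proof.
move=> [e_sym e_irr] econ <- m1 ew mc.
have /finset.set0Pn[E /imsetP[[a b] eab _]] : edges e != finset.set0.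
  by rewrite -card_gt0.
have {}eab : e a b by move: eab; rewrite !inE.
have t1 := asymmetry_ge1 ew eab.
apply: bigmax_le => [|x _]; first exact: leNye.
apply: bigmax_le => [|y _]; first exact: leNye.
apply: (exp_hitting_time_le mc) => N.
apply: (@subsolution_le _ _ _ _ _ e_sym e_irr econ ew t1 (asymmetryP ew) y) => //.
  by move=> v vy; exact: (truncated_time_subsolution N ew vy).
exact: truncated_time_target.
Qed.
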